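(* Let $\kappa$ be a regular uncountable cardinal and $\lambda>\kappa$ a cardinal. Let $\rho$ be a cardinal with $2\le\rho\le\kappa$. Then: (i) $H^+\xrightarrow[\kappa]{\kappa}[H^+]^2_\rho$ for every ideal $H$ on $P_\kappa(\lambda)$ such that $\mathrm{cof}(H)<\mathbf{non}_\kappa(J^+\to[J^+]^2_\rho)$. (ii) If $I_{\kappa,\lambda}^+\xrightarrow[\kappa]{\kappa}[I_{\kappa,\lambda}^+]^2_\rho$, then $\sigma<\overline{\mathbf{non}}_\kappa(J^+\to[J^+]^2_\rho)$ for every $\sigma\in\mathcal K(\kappa,\lambda)$.
   Context: For a cardinal $\mu$ and a set $A$, $P_\mu(A)=\{a\subseteq A:|a|<\mu\}$. An ideal on an infinite set $S$ is a collection $K$ of subsets of $S$ containing all singletons, closed under subsets and finite unions, with $S\notin K$; $K^+=P(S)\setminus K$; $\mathrm{cof}(K)$ is the least cardinality of an $X\subseteq K$ with $K=\bigcup_{A\in X}P(A)$; $\overline{\mathrm{cof}}(K)$ is the least cardinality of an $X\subseteq K$ with $K=\bigcup\{P(\bigcup x):x\in P_\kappa(X)\}$. $K$ is $\kappa$-complete if it is closed under unions of fewer than $\kappa$ members. ''Ideal on $\kappa$'' always means $\kappa$-complete ideal on $\kappa$. $I_{\kappa,\lambda}$ is the set of all $A\subseteq P_\kappa(\lambda)$ such that $A\cap\{b\in P_\kappa(\lambda):a\subseteq b\}=\emptyset$ for some $a\in P_\kappa(\lambda)$. ''Ideal on $P_\kappa(\lambda)$'' always means a $\kappa$-complete ideal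 $H$ on $P_\kappa(\lambda)$ that is fine ($I_{\kappa,\lambda}\subseteq H$). For $A\subseteq\kappa$, $[A]^2=\{(\xi,\eta)\in A\times A:\xi<\eta\}$. For an ideal $J$ on $\kappa$, $J^+\to[J^+]^2_\rho$ means: for every $A\in J^+$ and every $f:[A]^2\to\rho$ there is $B\in J^+\cap P(A)$ such that $f''[B]^2\neq\rho$. For a property $P$ failed by at least one ideal on $\kappa$, $\mathbf{non}_\kappa(P)$ (respectively $\overline{\mathbf{non}}_\kappa(P)$) is the least cardinal $\tau$ such that there is an ideal $J$ on $\kappa$ with $\mathrm{cof}(J)=\tau$ (respectively $\overline{\mathrm{cof}}(J)=\tau$) that does not satisfy $P$. For $A\subseteq P_\kappa(\lambda)$, $[A]^2_{\kappa,\kappa}=\{(\bigcup(a\cap\kappa),\bigcup(b\cap\kappa)):a,b\in A,\ \bigcup(a\cap\kappa)<\bigcup(b\cap\kappa)\}$. For an ideal $H$ on $P_\kappa(\lambda)$, $H^+\xrightarrow[\kappa]{\kappa}[H^+]^2_\rho$ means: for every $F:[P_\kappa(\lambda)]^2_{\kappa,\kappa}\to\rho$ and every $A\in H^+$ there is $B\in H^+\cap P(A)$ such that $F''[B]^2_{\kappa,\kappa}\ne\rho$. $\mathcal K(\kappa,\lambda)$ is the set of all cardinals $\sigma\ge\lambda$ for which there is $T\subseteq P_\kappa(\lambda)$ with $|T|=\sigma$ and $|T\cap P(a)|<\kappa$ for every $a\in P_\kappa(\lambda)$. *)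

(* Defs.v *)
From HB Require Import structures.
From mathcomp Require Import all_boot all_order.
From mathcomp Require Import mathcomp_extra boolp classical_sets functions.
From mathcomp Require Import cardinality wochoice.

Set Implicit Arguments.
Unset Strict Implicit.
Unset Printing Implicit Defensive.

Local Open Scope classical_set_scope.
Local Open Scope card_scope.

(* Cardinals occurring as values of cof, non, etc. are types considered up to
   equipotence. The single universe of [Card] is also the one of the types [T]
   below, so that every subset of such a type has a cardinal in [Card]. *)
Definition Card := Type.

Definition card_lt (T U : Type) (A : set T) (B : set U) : Prop :=
  A #<= B /\ ~ (B #<= A).
Notation "A '#<' B" := (card_lt A B) (at level 79) : card_scope.

Definition has_card (T : Card) (A : set T) (t : Card) : Prop :=
  A #= [set: t].

Definition Card_le (s t : Card) : Prop := [set: s] #<= [set: t].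
Definition Card_lt (s t : Card) : Prop := [set: s] #< [set: t].

Definition is_least (C : Card -> Prop) (t : Card) : Prop :=
  C t /\ forall u, C u -> Card_le t u.

(* P_mu(A), where mu is the cardinality of M *)
Definition smallsets (U T : Type) (M : set U) (A : set T) : set (set T) :=
  [set a | a `<=` A /\ a #< M].

Definition pow (T : Type) (A : set T) : set (set T) := [set a | a `<=` A].

Section Ideals.
Variables (U : Type) (T : Card).

Definition is_ideal (S : set T) (K : set (set T)) : Prop :=
  [/\ K `<=` pow S,
      forall x, S x -> K [set x],
      forall A B, K A -> B `<=` A -> K B,
      forall A B, K A -> K B -> K (A `|` B) &
      ~ K S].

Definition positive (S : set T) (K : set (set T)) : set (set T) :=
  pow S `\` K.

Definition complete (M : set U) (K : set (set T)) : Prop :=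
  forall X : set (set T), X `<=` K -> X #< M -> K (\bigcup_(A in X) A).

Definition is_cof (K : set (set T)) : Card -> Prop :=
  is_least (fun t => exists X : set (set T),
    [/\ X `<=` K, K = \bigcup_(A in X) pow A & has_card X t]).

Definition is_cofbar (M : set U) (K : set (set T)) : Card -> Prop :=
  is_least (fun t => exists X : set (set T),
    [/\ X `<=` K,
        K = \bigcup_(x in smallsets M X) pow (\bigcup_(A in x) A) &
        has_card X t]).

End Ideals.

(* Ordinals are the elements of a well-ordered type [L], an element [x] being
   identified with the set [below x] of its predecessors. *)
Section Ordinals.
Context {d : Order.disp_t} {L : orderType d}.

Definition below (x : L) : set L := [set y | (y < x)%O].

(* [S] (either [below x] or the whole of [L]) is a cardinal *)
Definition initial (S : set L) : Prop := forall x, S x -> below x #< S.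

Definition regular (k : L) : Prop :=
  forall A : set L, A `<=` below k ->
    (forall x, below k x -> exists2 y, A y & (x <= y)%O) -> below k #<= A.

Definition regular_uncountable_cardinal (k : L) : Prop :=
  [/\ initial (below k), ~ countable (below k) & regular k].

Definition ideal_on (k : L) (J : set (set L)) : Prop :=
  is_ideal (below k) J /\ complete (below k) J.

Definition pairs (A : set L) : set (L * L) :=
  [set p | [/\ A p.1, A p.2 & (p.1 < p.2)%O]].

(* A function defined on a subset of [L * L] is represented by a total function
   whose values outside that subset are irrelevant. *)
Definition square_bracket (k r : L) (J : set (set L)) : Prop :=
  forall (A : set L) (f : L * L -> L),
    positive (below k) J A -> set_fun (pairs A) (below r) f ->
    exists B, [/\ positive (below k) J B, B `<=` A &
                  f @` pairs B <> below r].

Definition is_non (k : L) (P : set (set L) -> Prop) : Card -> Prop :=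
  is_least (fun t => exists J, [/\ ideal_on k J, is_cof J t & ~ P J]).

Definition is_nonbar (k : L) (P : set (set L) -> Prop) : Card -> Prop :=
  is_least (fun t =>
    exists J, [/\ ideal_on k J, is_cofbar (below k) J t & ~ P J]).

(* P_kappa(lambda), where lambda is [L] *)
Definition Pkl (k : L) : set (set L) := smallsets (below k) [set: L].

Definition Ikl (k : L) : set (set (set L)) :=
  [set A | A `<=` Pkl k /\
           exists2 a, Pkl k a & A `&` [set b | Pkl k b /\ a `<=` b] = set0].

Definition ideal_on_Pkl (k : L) (H : set (set (set L))) : Prop :=
  [/\ is_ideal (Pkl k) H, complete (below k) H & Ikl k `<=` H].

(* [x] is the ordinal \bigcup (a \cap kappa) *)
Definition is_trace_sup (k : L) (a : set L) (x : L) : Prop :=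
  below x = \bigcup_(y in a `&` below k) below y.

Definition pairs_kk (k : L) (A : set (set L)) : set (L * L) :=
  [set p | (exists2 a, A a & is_trace_sup k a p.1) /\
           (exists2 b, A b & is_trace_sup k b p.2) /\ (p.1 < p.2)%O].

Definition square_bracket_kk (k r : L) (H : set (set (set L))) : Prop :=
  forall (F : L * L -> L) (A : set (set L)),
    set_fun (pairs_kk k (Pkl k)) (below r) F -> positive (Pkl k) H A ->
    exists B, [/\ positive (Pkl k) H B, B `<=` A &
                  F @` pairs_kk k B <> below r].

(* the class K(kappa, lambda) *)
Definition Kkl (k : L) (s : Card) : Prop :=
  Card_le L s /\
  exists T : set (set L),
    [/\ T `<=` Pkl k, has_card T s &
        forall a, Pkl k a -> T `&` pow a #< below k].

End Ordinals.

(* Main.v *)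
(* Both parts transfer ideals along [a |-> sup (a `&` kappa)].

   (i) For [A] positive, the sets [B] such that [{a in A : sup (a `&` kappa) in B}]
   lies in [H] form an ideal on kappa whose cofinality is at most that of [H], so
   the partition property of that ideal gives the one of [H].

   (ii) Suppose that [J] fails the relation at [f : [A]^2 -> rho] and that
   [cofbar(J) <= sigma]. Let [T] witness that [sigma] is in K(kappa,lambda). As
   lambda = |lambda \ kappa|, the sets in [T] may be moved off kappa by an injection
   [g]. Index by [t] in [T] a family [e t] that generates [J] under unions of fewer
   than kappa members, and let [Z a] be the union of the [e t] with
   [g @` t `<=` a]; it is in [J] by the choice of [T]. The set of [a] with
   [sup (a `&` kappa)] in [A `\` Z a] is positive, since [Z a] does not change when
   an ordinal below kappa is added to [a], and the traces of a positive subset of it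
   form a positive subset of [A]. Hence [f], transferred to P_kappa(lambda), violates
   the relation for I_{kappa,lambda}. *)

Require Import Defs.
From HB Require Import structures.
From mathcomp Require Import all_boot all_order.
From mathcomp Require Import mathcomp_extra boolp classical_sets functions.
From mathcomp Require Import cardinality wochoice.

Import Order.TTheory.

Local Open Scope classical_set_scope.
Local Open Scope card_scope.

(** * Comparison of cardinalities and least cardinals *)

Lemma card_le_rel {T U : Type} (A : set T) (B : set U) (R : T -> U -> Prop) :
  (forall x, A x -> exists2 y, B y & R x y) ->
  (forall x x' y, A x -> A x' -> R x y -> R x' y -> x = x') ->
  A #<= B.
Proof.
move=> Rtot Rinj; have [->|/set0P[x0 Ax0]] := eqVneq A set0.
  exact: card_ge0.
have [y0 _ _] := Rtot _ Ax0.
have /choice[f fP] (x : T) : exists y, A x -> B y /\ R x y.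
  by case: (pselect (A x)) => [/Rtot[y]|]; [exists y | exists y0].
have [|g] := (@injfunPex _ _ A B).2; last exact: inj_card_le.
exists f => [x /fP[]//|x x'].
by move=> /set_mem Ax /set_mem Ax' e; apply: (Rinj _ _ (f x)) => //;
  [exact: (fP _ Ax).2 | rewrite e; exact: (fP _ Ax').2].
Qed.

Lemma card_le_inj {T U : Type} (A : set T) (B : set U) (f : T -> U) :
  (forall x, A x -> B (f x)) ->
  (forall x x', A x -> A x' -> f x = f x' -> x = x') -> A #<= B.
Proof.
move=> fAB finj; apply: (@card_le_rel _ _ _ _ (fun x y => f x = y)).
  by move=> x /fAB; exists (f x).
by move=> x x' y Ax Ax' <- e; apply: finj.
Qed.

Lemma card_le_surj {T U : Type} {A : set T} {B : set U} :
  A #<= B -> A !=set0 ->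
  exists f : U -> T, (forall y, B y -> A (f y)) /\
                     (forall x, A x -> exists2 y, B y & f y = x).
Proof.
move=> /pfcard_geP[->|[f]]; first by case.
by exists f; split=> [y /(@funS _ _ _ _ f)//|x /(@surj _ _ _ _ f)[y]]; exists y.
Qed.

(* Zorn: a maximal set of pointwise disjoint choice functions exhausts some [F i],
   hence injects that [F i] into all the others. *)
Lemma card_least_family {I T : Type} (F : I -> set T) (i0 : I) :
  exists i, forall j, F i #<= F j.
Proof.
pose P (Phi : set (I -> T)) :=
  (forall f, Phi f -> forall i, F i (f i)) /\
  (forall f g i, Phi f -> Phi g -> f i = g i -> f = g).
have [|Phi [[PhiF Phi_inj] Phi_max]] := @Zorn_bigcup _ P.
  move=> C CP Ctot; split=> [f [Phi /CP[PF _]] /PF//|f g i].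
  move=> [Phi1 C1 f1] [Phi2 C2 g2].
  have [Phi C' [f' g']] : exists2 Phi, C Phi & Phi f /\ Phi g.
    by case: (Ctot _ _ C1 C2) => sub; [exists Phi2|exists Phi1];
      rewrite //; split=> //; exact: sub.
  exact: (CP _ C').2.
have [i iP] : exists i, forall x, F i x -> exists2 f, Phi f & f i = x.
  apply: contrapT => /forallNP noi.
  have /choice[f fP] i : exists x, F i x /\ forall g, Phi g -> g i <> x.
    have /existsNP[x /not_implyP[Fx nx]] := noi i.
    by exists x; split=> // g Pg e; apply: nx; exists g.
  apply: (Phi_max (Phi `|` [set f])).
    split; first by move=> ? ?; left.
    by move=> /(_ f (or_intror erefl)) Pf; exact: (fP i0).2 _ Pf erefl.
  split=> [g [/PhiF//|->] i|g h i]; first exact: (fP i).1.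
  case=> [Pg|->] [Ph|->] // e; first exact: (Phi_inj _ _ i).
    by case: ((fP i).2 _ Pg).
  by case: ((fP i).2 _ Ph).
exists i => j; apply: (@card_le_rel _ _ _ _
  (fun x y => exists2 f, Phi f & f i = x /\ f j = y)).
  by move=> x /iP[f Pf fx]; exists (f j); [exact: PhiF|exists f].
by move=> x x' y _ _ [f Pf [<- e]] [g Pg [<- e']];
  rewrite (Phi_inj f g j) // e e'.
Qed.

(** [A] and [B] may live in different types, so their copies in the sum type form the two-member
    family to which [card_least_family] applies. *)
Lemma card_le_total {T U : Type} (A : set T) (B : set U) :
  A #<= B \/ B #<= A.
Proof.
pose F (b : bool) : set (T + U) := if b then inl @` A else inr @` B.
have eA : F true #= A.
  by apply: inj_card_eq => x y _ _ [].
have eB : F false #= B.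
  by apply: inj_card_eq => x y _ _ [].
have [[] /= bP] := @card_least_family _ _ F true.
  by left; rewrite -(card_le_eql eA) -(card_le_eqr eB); exact: (bP false).
by right; rewrite -(card_le_eql eB) -(card_le_eqr eA); exact: (bP true).
Qed.

Lemma card_ltNge {T U : Type} (A : set T) (B : set U) :
  A #< B <-> ~ (B #<= A).
Proof.
by split=> [[]//|nBA]; split=> //; by case: (card_le_total A B).
Qed.

Lemma card_le_lt_trans {T U V : Type} (A : set T) (B : set U) (C : set V) :
  A #<= B -> B #< C -> A #< C.
Proof.
move=> AB [BC nCB]; apply/card_ltNge => CA.
by apply: nCB; exact: card_le_trans CA AB.
Qed.

(** The candidates of size at most [t0] are represented by subsets of [t0], which form a family
    indexed by a type; by comparability all others are at least as large as [t0]. *)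
Lemma is_least_exists (C : Card -> Prop) (t0 : Card) :
  C t0 -> exists t, is_least C t.
Proof.
move=> Ct0.
pose I := {A : set t0 | exists2 u, C u & A #= [set: u]}.
have I0 : exists2 u, C u & [set: t0] #= [set: u] by exists t0.
have [[A [t Ct At]] /= Amin] :=
  @card_least_family I t0 (fun i => proj1_sig i) (exist _ _ I0).
exists t; split=> // u Cu; rewrite /Card_le -(card_le_eql At).
have [le_u|] := card_le_total [set: t0] [set: u].
  exact: card_le_trans (card_leT A) le_u.
move=> /card_subP[B Bu _].
have IB : exists2 u, C u & B #= [set: u] by exists u.
by rewrite -(card_le_eqr Bu); exact: Amin (exist _ B IB).
Qed.

Lemma has_card_exists {T : Card} (A : set T) : exists t, has_card A t.
Proof.
by exists A; rewrite /has_card; exact: card_setT_sym.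
Qed.

Lemma card_le_fun {T U : Type} {A : set T} {B : set U} :
  A #<= B -> A !=set0 ->
  exists f : T -> U, (forall x, A x -> B (f x)) /\
                     (forall x x', A x -> A x' -> f x = f x' -> x = x').
Proof.
move=> AB A0; have [h [_ hP]] := card_le_surj AB A0.
have [y0 _ _] : exists2 y, B y & True by case: A0 => x /hP[y]; exists y.
have /choice[f fP] (x : T) : exists y, A x -> B y /\ h y = x.
  by case: (pselect (A x)) => [/hP[y]|]; [exists y|exists y0].
exists f; split=> [x /fP[]//|x x' Ax Ax' e].
by rewrite -(fP _ Ax).2 e (fP _ Ax').2.
Qed.

(* By Zorn, all but finitely many points of [A] are partitioned into countable
   sequences, each of which splits into its even and its odd terms. *)
Lemma card_setU_infinite {T : Type} (A B : set T) :
  infinite_set A -> B #<= A -> A `|` B #<= A.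
Proof.
move=> Ainf BA.
pose P (Phi : set (nat -> T)) :=
  (forall f, Phi f -> forall n, A (f n)) /\
  (forall f g m n, Phi f -> Phi g -> f m = g n -> f = g /\ m = n).
have [|Phi [[PhiA Phi_inj] Phi_max]] := @Zorn_bigcup _ P.
  move=> C CP Ctot; split=> [f [Phi /CP[PA _] /PA]//|f g m n].
  move=> [Phi1 C1 f1] [Phi2 C2 g2].
  have [Phi C' [f' g']] : exists2 Phi, C Phi & Phi f /\ Phi g.
    by case: (Ctot _ _ C1 C2) => sub; [exists Phi2|exists Phi1];
      rewrite //; split=> //; exact: sub.
  exact: (CP _ C').2.
pose U := [set x | exists2 f, Phi f & exists n, f n = x].
have UA : U `<=` A by move=> _ [f Pf [n <-]]; exact: PhiA.
have doubling (X Y : set T) : X #<= U -> Y #<= U -> X `|` Y #<= U.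
  have [->|/set0P[x0 Xx0] XU] := eqVneq X set0; first by rewrite set0U.
  have [->|/set0P[y0 Yy0] YU] := eqVneq Y set0; first by rewrite setU0.
  have [a [_ aP]] := card_le_surj XU (ex_intro _ _ Xx0).
  have [b [_ bP]] := card_le_surj YU (ex_intro _ _ Yy0).
  apply: (@card_le_rel _ _ _ _ (fun x y => exists2 f, Phi f & exists n,
    (a (f n) = x /\ y = f n.*2) \/ (b (f n) = x /\ y = f n.*2.+1))).
    move=> x [/aP|/bP] [_ [f Pf [n <-]] e].
      by exists (f n.*2); [exists f => //; exists n.*2|
        exists f => //; exists n; left].
    by exists (f n.*2.+1); [exists f => //; exists n.*2.+1|
      exists f => //; exists n; right].
  move=> x x' y _ _ [f Pf [m fm]] [g Pg [n gn]].
  move: fm gn => [[<- ->]|[<- ->]] [[<-]|[<-]] /Phi_inj[]// ->.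
  - by move/double_inj ->.
  - by move/(congr1 odd); rewrite /= !odd_double.
  - by move/(congr1 odd); rewrite /= !odd_double.
  - by move=> [/double_inj ->].
(* An infinite remainder would contain one more sequence, disjoint from those in [Phi]. *)
have remainder_finite : finite_set (A `\` U).
  apply: contrapT => /infiniteP natAU.
  have [f fAU f_inj] : exists2 f : nat -> T,
      (forall n, (A `\` U) (f n)) & injective f.
    have [|f [fAU f_inj]] := card_le_fun natAU; first by exists 0%N.
    by exists f => [n|m n]; [exact: fAU|exact: f_inj].
  apply: (Phi_max (Phi `|` [set f])).
    split; first by move=> ? ?; left.
    move=> /(_ f (or_intror erefl)) Pf.
    by apply: (fAU 0).2; exists f => //; exists 0.
  split=> [g [/PhiA//|->] n|g h m n]; first exact: (fAU n).1.
  case=> [Pg|->] [Ph|->]; first exact: Phi_inj.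
  - by move=> e; case: (fAU n).2; exists g => //; exists m.
  - by move=> e; case: (fAU m).2; exists h => //; exists n.
  - by move=> /f_inj ->.
have Uinf : infinite_set U.
  move=> Ufin; apply: Ainf; rewrite -(setDUK UA).
  by rewrite finite_setU.
(* The finite remainder is countable, hence embeds in the infinite set [U], and [doubling] absorbs
   it. *)
have AU : A #<= U.
  rewrite -(setDUK UA); apply: doubling; first exact: card_lexx.
  apply: card_le_trans (finite_set_countable remainder_finite) _.
  exact/infiniteP.
apply: card_le_trans (subset_card_le UA); apply: doubling => //.
exact: card_le_trans BA AU.
Qed.

(** * Sets of size less than kappa and the suprema of their traces on kappa *)

Section RegularCardinal.
Context {d : Order.disp_t} {L : orderType d}.
Hypothesis L_wo : well_order (<=%O : rel L).
Context {k : L}.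
Hypothesis k_reg : regular_uncountable_cardinal k.

Lemma wo_least {P : set L} :
  P !=set0 -> exists2 x, P x & forall y, P y -> (x <= y)%O.
Proof.
move=> [x Px]; have [|z [[zP zmin] _]] := L_wo [in P].
  by exists x; exact/mem_set.
by exists z => [|y Py]; [exact/set_mem|apply: zmin; exact/mem_set].
Qed.

Lemma below_inj (x y : L) : below x = below y -> x = y.
Proof.
move=> e; apply/le_anti/andP; split; rewrite leNgt; apply/negP => xy.
  by have : below x y by []; rewrite e /below /= ltxx.
by have : below y x by []; rewrite -e /below /= ltxx.
Qed.

Lemma below_infinite : infinite_set (below k).
Proof.
by case: k_reg => _ kunc _ /finite_set_countable.
Qed.

Lemma finite_lt_below {T : Type} (A : set T) : finite_set A -> A #< below k.
Proof.
move=> Afin; apply/card_ltNge => kA.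
by apply: below_infinite; exact: card_le_finite kA Afin.
Qed.

Lemma lt_card_bounded {S : set L} : S `<=` below k -> S #< below k ->
  exists2 x, below k x & forall y, S y -> (y < x)%O.
Proof.
case: k_reg => _ _ kreg Sk [_ nkS]; apply: contrapT => nb; apply: nkS.
apply: kreg => // x kx; apply: contrapT => nx; apply: nb; exists x => // y Sy.
by rewrite ltNge; apply/negP => xy; apply: nx; exists y.
Qed.

(** Otherwise some [h] maps the union onto [below k]. By regularity each image of [F i] has a bound
    [b i], and the [b i] have a common bound [x] below [k], which is then not a value of [h]. *)
Lemma below_bigcup_lt {I T : Type} (S : set I) (F : I -> set T) :
  S #< below k -> (forall i, S i -> F i #< below k) ->
  \bigcup_(i in S) F i #< below k.
Proof.
move=> Sk Fk; apply/card_ltNge => /card_le_surj[].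
  exact: infinite_setN0 below_infinite.
move=> h [hk hsurj].
have /choice[b bP] (i : I) :
    exists x, S i -> below k x /\ forall y, F i y -> (h y < x)%O.
  case: (pselect (S i)) => [Si|]; last by exists k.
  have [_ [y Fy <-]||x kx xP] := @lt_card_bounded (h @` F i).
  - by apply: hk; exists i.
  - exact: card_le_lt_trans (card_image_le _ _) (Fk _ Si).
  - by exists x => _; split=> // y Fy; apply: xP; exists y.
have [_ [i Si <-]||x kx xP] := @lt_card_bounded (b @` S).
- exact: (bP _ Si).1.
- exact: card_le_lt_trans (card_image_le _ _) Sk.
have [y [i Si Fy] e] := hsurj _ kx.
have := lt_trans ((bP _ Si).2 _ Fy) (xP _ (ex_intro2 _ _ i Si erefl)).
by rewrite e ltxx.
Qed.

Lemma PklP (a : set L) : Pkl k a <-> a #< below k.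
Proof. by split=> [[]|]. Qed.

Lemma Pkl_bigcup {I : Type} (S : set I) (F : I -> set L) :
  S #< below k -> (forall i, S i -> Pkl k (F i)) ->
  Pkl k (\bigcup_(i in S) F i).
Proof.
by move=> Sk Fk; apply/PklP/below_bigcup_lt => // i /Fk/PklP.
Qed.

Lemma Pkl_set1 (x : L) : Pkl k [set x].
Proof. exact/PklP/finite_lt_below/finite_set1. Qed.

Lemma Pkl_setU (a b : set L) : Pkl k a -> Pkl k b -> Pkl k (a `|` b).
Proof.
move=> ka kb; rewrite -bigcup2inE.
apply: Pkl_bigcup => [|[|[|]]//].
exact/finite_lt_below/finite_II.
Qed.

Lemma Pkl_bounded {a : set L} : Pkl k a ->
  exists2 x, below k x & forall y, a y -> below k y -> (y < x)%O.
Proof.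
move=> /PklP ak; have [||x kx xP] := @lt_card_bounded (a `&` below k).
- by move=> ? [].
- exact: card_le_lt_trans (subset_card_le (@subIsetl _ _ _)) ak.
by exists x => // y ay ky; exact: xP.
Qed.

(** The witness is the least weak upper bound of the trace; by minimality every smaller ordinal lies
    below a member of the trace. *)
Lemma trace_sup_exists (a : set L) : Pkl k a ->
  exists x, below k x /\ is_trace_sup k a x.
Proof.
move=> /Pkl_bounded[x0 kx0 x0P].
have [|x xub xmin] :=
  @wo_least [set x | forall y, (a `&` below k) y -> (y <= x)%O].
  by exists x0 => y [ay ky]; exact/ltW/x0P.
exists x; split.
  by apply: le_lt_trans kx0; apply: xmin => y [ay ky]; exact/ltW/x0P.
apply/seteqP; split=> [z zx|z [y aky zy]]; last exact: lt_le_trans (xub _ aky).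
apply: contrapT => nz; have : (x <= z)%O; last by rewrite leNgt zx.
apply: xmin => y aky; rewrite leNgt; apply/negP => zy.
by apply: nz; exists y.
Qed.

Lemma trace_sup_unique {a : set L} {x y : L} :
  is_trace_sup k a x -> is_trace_sup k a y -> x = y.
Proof. by move=> ax ay; apply: below_inj; rewrite ax. Qed.

Lemma trace_sup_ge {a : set L} {x y : L} :
  is_trace_sup k a x -> a y -> below k y -> (y <= x)%O.
Proof.
move=> ax ay ky; rewrite leNgt; apply/negP => xy.
have : below x x by rewrite ax; exists y.
by rewrite /below /= ltxx.
Qed.

Lemma trace_sup_setU1 (a : set L) (x : L) : below k x ->
  (forall y, a y -> below k y -> (y <= x)%O) ->
  is_trace_sup k (a `|` [set x]) x.
Proof.
move=> kx ax; apply/seteqP; split=> [z zx|z [y [ay ky] zy]].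
  by exists x => //; split=> //; right.
by case: ay => [/ax/(_ ky)|<-//]; exact: lt_le_trans.
Qed.

Lemma not_IklP (A : set (set L)) : A `<=` Pkl k ->
  ~ Ikl k A <-> forall a, Pkl k a -> exists2 b, A b & a `<=` b.
Proof.
move=> Ak; split=> [nA a ka|Acof [_ [a ka /seteqP[+ _]]]].
  apply: contrapT => nb; apply: nA; split=> //; exists a => //.
  by apply/seteqP; split=> // b [Ab [_ ab]]; apply: nb; exists b.
by have [b Ab ab] := Acof _ ka; move/(_ b); apply; split=> //; split=> //; exact: Ak.
Qed.

(** An initial segment is a union of singletons, fewer than kappa of them because kappa is a
    cardinal. *)
Lemma ideal_on_bounded (J : set (set L)) (x : L) :
  ideal_on k J -> below k x -> J (below x).
Proof.
move=> [[_ J1 _ _ _] Jc] kx.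
have -> : below x = \bigcup_(A in (@set1 L) @` below x) A.
  apply/seteqP; split=> [y yx|y [_ [z zx <-]] ->//].
  by exists [set y] => //; exists y.
apply: Jc => [_ [y yx <-]|]; first by apply: J1; exact: lt_trans yx kx.
apply: card_le_lt_trans (card_image_le _ _) _.
by case: k_reg => + _ _; apply.
Qed.

End RegularCardinal.

(** * Part (i): ideals projected from P_kappa(lambda) to kappa *)

Lemma is_cof_exists {T : Card} {K X : set (set T)} :
  X `<=` K -> K = \bigcup_(A in X) pow A ->
  exists2 t, is_cof K t & [set: t] #<= X.
Proof.
move=> XK KX; have [u Xu] := has_card_exists X.
have [|t tcof] := @is_least_exists (fun t => exists X : set (set T),
    [/\ X `<=` K, K = \bigcup_(A in X) pow A & has_card X t]) u.
  by exists X.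
exists t => //; rewrite (card_le_eqr Xu); apply: tcof.2.
by exists X.
Qed.

Section Projection.
Context {d : Order.disp_t} {L : orderType d}.
Context {k : L}.
Hypothesis k_reg : regular_uncountable_cardinal k.
Context {s : set L -> L}.
Hypothesis sP : forall a, Pkl k a -> below k (s a) /\ is_trace_sup k a (s a).
Context {H : set (set (set L))} {A : set (set L)}.
Hypothesis H_ideal : ideal_on_Pkl k H.
Hypothesis A_pos : positive (Pkl k) H A.

(* The image of the restriction of [H] to [A] under [s]. *)
Let J : set (set L) := [set B | B `<=` below k /\ H (A `&` s @^-1` B)].

Let AP a : A a -> Pkl k a.
Proof. by case: A_pos => + _; apply. Qed.

Lemma ideal_on_projection : ideal_on k J.
Proof.
have [[HP H1 Hsub HU HN] Hc HI] := H_ideal.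
split; first split.
- by move=> B [].
- move=> x kx; split; first by move=> _ ->.
  have [_ ->//||y ky xy] := @lt_card_bounded _ _ _ k_reg [set x].
    exact/finite_lt_below/finite_set1.
  (* Fineness gives singletons: no [a] containing [y] has the smaller ordinal [x] as its trace
     supremum. *)
  apply: HI; split; first by move=> a [/AP].
  exists [set y]; first exact: Pkl_set1.
  apply/seteqP; split=> // a [[Aa /= sax] [_ ya]].
  have := trace_sup_ge (sP _ (AP _ Aa)).2 (ya _ erefl) ky.
  by rewrite sax leNgt xy.
- move=> B C [Bk HB] CB; split; first exact: subset_trans CB Bk.
  by apply: Hsub HB _ => a [Aa /CB].
- move=> B C [Bk HB] [Ck HC]; split; first by rewrite subUset.
  by rewrite preimage_setU setIUr; exact: HU.
- move=> [_]; rewrite (_ : A `&` _ = A); first by case: A_pos.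
  by apply/seteqP; split=> [a []//|a Aa]; split=> //; exact: (sP _ (AP _ Aa)).1.
move=> X XJ Xk; split; first by move=> x [B /XJ[+ _]]; apply.
have -> : A `&` s @^-1` (\bigcup_(B in X) B) =
    \bigcup_(C in (fun B => A `&` s @^-1` B) @` X) C.
  apply/seteqP; split=> [a [Aa [B XB Bsa]]|a [_ [B XB <-] [Aa Bsa]]].
    by exists (A `&` s @^-1` B) => //; exists B.
  by split=> //; exists B.
apply: Hc => [_ [B /XJ[_ HB] <-]//|].
exact: card_le_lt_trans (card_image_le _ _) Xk.
Qed.

(** The map [core] sends a generating family of [H] onto one of [J], so the cofinality does not
    grow. *)
Lemma is_cof_projection (mu : Card) :
  is_cof H mu -> exists2 t, is_cof J t & Card_le t mu.
Proof.
have [[HP _ Hsub _ _] _ _] := H_ideal.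
move=> [[X [XH HX Xmu]] _].
(* The largest [B] such that [A `&` s @^-1` B] is included in [D]. *)
pose core (D : set (set L)) : set L :=
  [set x | below k x /\ forall a, A a -> s a = x -> D a].
have [||t tcof tX] := @is_cof_exists _ J (core @` X).
- move=> _ [D /XH HD <-]; split; first by move=> x [].
  by apply: Hsub HD _ => a [Aa [_ /(_ a Aa erefl)]].
- apply/seteqP; split=> [B [Bk]|B [_ [D /XH HD <-] BD]].
    rewrite HX => -[D XD ABD]; exists (core D); first by exists D.
    move=> x Bx; split; first exact: Bk.
    by move=> a Aa sa; apply: ABD; split=> //=; rewrite sa.
  split; first by move=> x /BD[].
  by apply: Hsub HD _ => a [Aa /BD[_ /(_ a Aa erefl)]].
exists t => //; apply: card_le_trans tX _.
by rewrite -(card_le_eqr Xmu); exact: card_image_le.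
Qed.

Lemma square_bracket_kk_projection (r : L) (F : L * L -> L) :
  square_bracket k r J -> set_fun (pairs_kk k (Pkl k)) (below r) F ->
  exists B, [/\ positive (Pkl k) H B, B `<=` A & F @` pairs_kk k B <> below r].
Proof.
have [[HP _ Hsub _ _] _ _] := H_ideal.
have [[_ _ _ _ kJ] _] := ideal_on_projection.
move=> Jr Fr.
(* Every [x] below [k] is the trace supremum of its singleton, so [F] colours all pairs below
   [k]. *)
have pairsF : set_fun (pairs (below k)) (below r) F.
  move=> p [p1 p2 p12]; apply: Fr.
  have tr x : below k x -> exists2 a, Pkl k a & is_trace_sup k a x.
    move=> kx; exists (set0 `|` [set x]); last exact: trace_sup_setU1.
    by rewrite set0U; exact: Pkl_set1.
  by split; [exact: tr|split=> //; exact: tr].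
(* The relation is applied to kappa itself, since [J] already incorporates the restriction to
   [A]. *)
have [|B [[Bk nJB] _ FB]] := Jr (below k) F _ pairsF.
  by split=> // x.
have sub : pairs_kk k (A `&` s @^-1` B) `<=` pairs B.
  move=> p [[a [Aa Ba] pa] [[b [Ab Bb] pb] p12]]; split=> //.
    by rewrite (trace_sup_unique pa (sP _ (AP _ Aa)).2).
  by rewrite (trace_sup_unique pb (sP _ (AP _ Ab)).2).
exists (A `&` s @^-1` B); split; last 1 first.
(* The inclusion [sub] suffices: [F] stays in [below r] on [pairs B], so taking every colour on the
   smaller set means taking every colour on [pairs B]. *)
- move=> e; apply: FB; apply/seteqP; split=> [_ [p [p1 p2 p12] <-]|x].
    by apply: pairsF; split=> //; exact: Bk.
  by rewrite -e => -[p /sub Bp <-]; exists p.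
- by split=> [a [/AP]//|HB]; apply: nJB; split.
- by move=> a [].
Qed.

End Projection.

Lemma square_bracket_kk_of_cof {d : Order.disp_t} {L : orderType d}
    (L_wo : well_order (<=%O : rel L)) (k r : L)
    (k_reg : regular_uncountable_cardinal k) (H : set (set (set L))) (mu : Card) :
  ideal_on_Pkl k H -> is_cof H mu ->
  (forall tau : Card, is_non k (square_bracket k r) tau -> Card_lt mu tau) ->
  square_bracket_kk k r H.
Proof.
move=> Hid Hmu mu_lt F A Fr Apos.
have /choice[s sP] (a : set L) :
    exists x, Pkl k a -> below k x /\ is_trace_sup k a x.
  by case: (pselect (Pkl k a)) => [/(trace_sup_exists L_wo k_reg)[x]|];
    [exists x|exists k].
have Jid := ideal_on_projection k_reg sP Hid Apos.
have [t Jt t_mu] := is_cof_projection (s := s) (A := A) Hid _ Hmu.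
apply: (square_bracket_kk_projection k_reg sP Hid Apos) => //.
(* If the projected ideal failed the relation, non would have a value [tau] at most its cofinality
   [t], hence at most [mu], against the hypothesis. *)
apply: contrapT => nJ.
have [|tau [tauC tau_min]] := @is_least_exists (fun t => exists J,
    [/\ ideal_on k J, is_cof J t & ~ square_bracket k r J]) t.
  by eexists; split; [exact: Jid|exact: Jt|exact: nJ].
have [_] : Card_lt mu tau by apply: mu_lt; split.
apply; apply: card_le_trans t_mu; apply: tau_min.
by eexists; split; [exact: Jid|exact: Jt|exact: nJ].
Qed.

(** * Part (ii): from kappa to P_kappa(lambda) *)

Lemma inj_outside_below {d : Order.disp_t} {L : orderType d}
    (L_card : initial [set: L]) (k : L) (k_inf : infinite_set (below k)) :
  exists2 g : L -> L, injective g & forall x, ~ below k (g x).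
Proof.
have [_ nLk] : below k #< [set: L] by exact: L_card.
(* Were the complement of kappa no larger than kappa, absorption would make lambda no larger than
   kappa. *)
have kC : below k #<= ~` below k.
  have [//|Ck] := card_le_total (below k) (~` below k).
  by case: nLk; rewrite -(setUv (below k)); exact: card_setU_infinite.
have LC : [set: L] #<= ~` below k.
  rewrite -(setUv (below k)) setUC; apply: card_setU_infinite => //.
  by move=> /(card_le_finite kC).
have [|g [gk g_inj]] := card_le_fun LC; first by exists k.
by exists g => [x y|x]; [exact: g_inj|exact: gk].
Qed.

Lemma square_bracket_of_cofbar {d : Order.disp_t} {L : orderType d}
    (L_card : initial [set: L]) (k r : L)
    (k_reg : regular_uncountable_cardinal k) (r0 : below r !=set0)
    (sigma tau : Card) (J : set (set L)) :
  square_bracket_kk k r (Ikl k) -> Kkl k sigma ->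
  ideal_on k J -> is_cofbar (below k) J tau -> Card_le tau sigma ->
  square_bracket k r J.
Proof.
move=> Ir [_ [T [Tk Tsigma T_lt]]] Jid [[X [XJ JX Xtau]] _] tau_sigma A f.
move=> [Ak nJA] fr; apply: contrapT => no_homog.
have [[JP J1 Jsub JU JN] Jc] := Jid.
have k_inf := below_infinite k_reg.
have [x0 kx0] := infinite_setN0 k_inf.
have [g g_inj gk] := inj_outside_below L_card k k_inf.
have XT : X #<= T.
  by rewrite (card_le_eql Xtau) (card_le_eqr Tsigma).
(* The surjection [e] from [T] requires a generator; covering the singleton of [x0] provides one. *)
have X0 : X !=set0.
  have := J1 _ kx0; rewrite JX => -[x [xX _] /(_ x0 erefl)[B xB _]].
  by exists B; exact: xX.
have [e [eX e_surj]] := card_le_surj XT X0.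
pose Z (a : set L) := \bigcup_(t in T `&` [set t | g @` t `<=` a]) e t.
have JZ a : Pkl k a -> J (Z a).
  move=> ka; rewrite (_ : Z a =
      \bigcup_(B in e @` (T `&` [set t | g @` t `<=` a])) B).
    apply: Jc => [_ [t [/eX Xt _] <-]|]; first exact: XJ.
    apply: card_le_lt_trans (card_image_le _ _) _.
    (* The sets [t] involved are subsets of the preimage of [a], which is small by injectivity of
       [g]; so [T_lt] leaves fewer than kappa of them. *)
    have ka' : Pkl k (g @^-1` a).
      apply/PklP; move/PklP: ka; apply: card_le_lt_trans.
      by apply: (@card_le_inj _ _ _ _ g) => // x y _ _ /g_inj.
    apply: card_le_lt_trans (T_lt _ ka').
    by apply: subset_card_le => t [Tt ta]; split=> // x tx; apply: ta; exists x.
  by rewrite bigcup_image.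
pose C := [set a | Pkl k a /\ exists2 x, is_trace_sup k a x & (A `\` Z a) x].
have Cpos : positive (Pkl k) (Ikl k) C.
  split; first by move=> a [].
  apply/not_IklP => [a []//|a ka].
  have [y ky yP] := Pkl_bounded k_reg ka.
  (* Otherwise [A] would be included in the union of [Z a] and [below y], both in [J]. *)
  have [x [Ax nZx] yx] : exists2 x, (A `\` Z a) x & (y <= x)%O.
    apply: contrapT => nx; apply: nJA.
    apply: Jsub (JU _ _ (JZ _ ka) (ideal_on_bounded k_reg _ _ Jid ky)) _ => x Ax.
    apply: contrapT => /not_orP[nZx nyx]; apply: nx; exists x => //.
    by rewrite leNgt; exact/negP.
  have kb : Pkl k (a `|` [set x]) by apply: Pkl_setU => //; exact: Pkl_set1.
  exists (a `|` [set x]); last by move=> ?; left.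
  split=> //; exists x.
    apply: trace_sup_setU1; first exact: Ak.
    by move=> z az kz; apply: ltW; apply: lt_le_trans yx; exact: yP.
  split=> // -[t [Tt ta] etx]; apply: nZx; exists t => //; split=> // _ [z tz <-].
  have [//|/= gzx] := ta _ (ex_intro2 _ _ z tz erefl).
  by case: (gk z); rewrite gzx; exact: Ak.
(* Outside [pairs A] the values of [f] are not controlled, so [F] takes there a default value in
   [below r]. *)
pose F p := if pselect (pairs A p) then f p else projT1 (cid r0).
have Fr : set_fun (pairs_kk k (Pkl k)) (below r) F.
  by move=> p _; rewrite /F; case: pselect => [Ap|nAp] /=; [exact: fr|case: cid].
have [B [[Bk nIB] BC FB]] := Ir F C Fr Cpos.
pose B' := [set x | exists2 b, B b & is_trace_sup k b x].
have B'P b x : B b -> is_trace_sup k b x -> (A `\` Z b) x.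
  by move=> Bb xb; have [_ [y yb]] := BC _ Bb; rewrite (trace_sup_unique xb yb).
have B'A : B' `<=` A by move=> x [b Bb /(B'P _ _ Bb)[]].
have pairsB' : pairs B' = pairs_kk k B.
  by apply/seteqP; split=> p [p1]; [move=> p2 p12|move=> [p2 p12]]; split.
apply: no_homog; exists B'; split=> //.
  split; first exact: subset_trans B'A Ak.
  (* If [B'] were in [J], a family [S] of fewer than kappa generators would cover it. Indexing [S]
     by members of [T] and collecting their images under [g] gives [a]. For [b] in [B] containing
     [a], the set [Z b] covers [B'], whereas the trace supremum of [b] is in [B'] and outside
     [Z b]. *)
  rewrite JX => -[S [SX Sk] B'S].
  have /choice[h hP] (D : set L) : exists t, S D -> T t /\ e t = D.
    by case: (pselect (S D)) => [/SX/e_surj[t]|]; [exists t|exists set0].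
  pose a := \bigcup_(D in S) g @` h D.
  have ka : Pkl k a.
    apply: Pkl_bigcup => // D SD; apply/PklP.
    apply: card_le_lt_trans (card_image_le _ _) _.
    exact/PklP/Tk/(hP _ SD).1.
  have [b Bb ab] := (not_IklP _ Bk).1 nIB _ ka.
  have [_ [x bx [_ nZx]]] := BC _ Bb.
  have [|D SD Dx] := B'S x; first by exists b.
  apply: nZx; exists (h D); last by rewrite (hP _ SD).2.
  split; first exact: (hP _ SD).1.
  by apply: subset_trans ab => y hy; exists D.
(* [F] and [f] agree on [pairs B'], because [B'] is a subset of [A]. *)
have -> : f @` pairs B' = F @` pairs_kk k B; last exact: FB.
rewrite -pairsB'; apply: eq_imagel => p [p1 p2 p12].
by rewrite /F; case: (pselect (pairs A p)) => // -[]; split=> //; exact: B'A.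
Qed.

(* lambda is L, kappa is k (so kappa < lambda), rho is r.  In (i), mu = cof(H);
   "mu < non" is read with the least element of an empty class being infinite. *)
Theorem theorem15p1 (d : Order.disp_t) (L : orderType d)
    (L_wo : well_order (<=%O : rel L)) (L_card : initial [set: L])
    (k : L) (k_reg : regular_uncountable_cardinal k)
    (r : L) (r_card : initial (below r))
    (r_ge2 : `I_2 #<= below r) (r_le : (r <= k)%O) :
  (forall (H : set (set (set L))) (mu : Card),
      ideal_on_Pkl k H -> is_cof H mu ->
      (forall tau : Card, is_non k (square_bracket k r) tau -> Card_lt mu tau) ->
      square_bracket_kk k r H)
  /\
  (square_bracket_kk k r (Ikl k) ->
   forall sigma : Card, Kkl k sigma ->
   forall tau : Card, is_nonbar k (square_bracket k r) tau ->
     Card_lt sigma tau).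
Proof.
split=> [H mu|Ir sigma Ks tau [[J [Jid Jtau nJ]] _]].
  exact: square_bracket_kk_of_cof.
apply/card_ltNge => tau_sigma; apply: nJ.
apply: square_bracket_of_cofbar tau_sigma => //.
apply/set0P/eqP => r0; move: r_ge2; rewrite r0 card_le0 => /eqP e0.
by have : `I_2 0%N by []; rewrite e0.
Qed.
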